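(* Let $\mathcal{M}=(X,\leq,V)$ and $\mathcal{M}'=(X',\leq',V')$ be intuitionistic Kripke models that are both pre-image-compact for $\mathsf{Int}^{\partial}$, and let $x\in X$, $x'\in X'$. Then $x$ and $x'$ are $\mathsf{Int}^{\partial}$-bisimilar if and only if they satisfy exactly the same $\mathsf{Int}^{\partial}$-formulae.
   Context: Fix a set $\mathrm{Prop}$ of propositional variables. $\mathsf{Int}^{\partial}$ is the set of formulae $\phi ::= \top\mid\bot\mid p\mid \phi\wedge\phi\mid\phi\vee\phi\mid\phi\,{-\!\!<}\,\phi$ (subtraction). An intuitionistic Kripke model is $(X,\leq,V)$ with $\leq$ a preorder on $X$ and $V$ assigning to each $p\in\mathrm{Prop}$ an upset of $(X,\leq)$. Truth: $\top,\bot,p,\wedge,\vee$ as usual ($x\Vdash p$ iff $x\in V(p)$), and $x\Vdash\phi\,{-\!\!<}\,\psi$ iff there exists $y\leq x$ with $y\Vdash\phi$ and $y\not\Vdash\psi$. For upsets $a,b$ let $a\ominus b=\{x\mid\exists y\leq x,\ y\in a,\ y\notin b\}$. A model is pre-image-compact for $\mathsf{Int}^{\partial}$ if there exists a collection $A$ of upsets of $(X,\leq)$ containing $\emptyset$, $X$ and all $V(p)$, closed under finite unions, finite intersections and $\ominus$, such that for every $x\in X$ the set ${\downarrow}x=\{y\mid y\leq x\}$ is compact in the topology $\tau_A$ generated by the subbase $A\cup\{X\setminus a\mid a\in A\}$. An $\mathsf{Int}^{\partial}$-bisimulation between $(X,\leq,V)$ and $(X',\leq',V')$ is a relation $B\subseteq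 X\times X'$ such that for all $(x,x')\in B$: (B1) for all $p$, $x\in V(p)$ iff $x'\in V'(p)$; (B4) if $y\leq x$ then there is $y'$ with $y'\leq' x'$ and $yBy'$; (B5) if $y'\leq' x'$ then there is $y$ with $y\leq x$ and $yBy'$. Two states are $\mathsf{Int}^{\partial}$-bisimilar if some $\mathsf{Int}^{\partial}$-bisimulation contains the pair. *)

(* Defs.v *)
From HB Require Import structures.
From mathcomp Require Import all_boot.
From mathcomp Require Import boolp classical_sets.
From mathcomp Require Import topology_structure compact.

Set Implicit Arguments.
Unset Strict Implicit.
Unset Printing Implicit Defensive.

Local Open Scope classical_set_scope.

Inductive formula (P : Type) : Type :=
| Top
| Bot
| Var of P
| And of formula P & formula P
| Or of formula P & formula P
| Sub of formula P & formula P.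

Definition upset (X : Type) (le : X -> X -> Prop) (a : set X) : Prop :=
  forall x y, le x y -> a x -> a y.

Record model (P : Type) : Type := Model {
  state :> Type;
  le : state -> state -> Prop;
  le_refl : forall x, le x x;
  le_trans : forall x y z, le x y -> le y z -> le x z;
  val : P -> set state;
  val_upset : forall p, upset le (val p)
}.

Fixpoint sat (P : Type) (M : model P) (x : M) (phi : formula P) : Prop :=
  match phi with
  | Top => True
  | Bot => False
  | Var p => val p x
  | And phi1 phi2 => sat x phi1 /\ sat x phi2
  | Or phi1 phi2 => sat x phi1 \/ sat x phi2
  | Sub phi1 phi2 => exists y : M, [/\ le y x, sat y phi1 & ~ sat y phi2]
  end.

Definition ominus (P : Type) (M : model P) (a b : set M) : set M :=
  [set x | exists y : M, [/\ le y x, a y & ~ b y]].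

Definition downset (P : Type) (M : model P) (x : M) : set M :=
  [set y | le y x].

(* [tau A] is the type [X] carrying the topology with subbase
   A `|` {~` a | a in A}.  Topological types must be choice types; the classical
   instances below provide this for an arbitrary [X]. *)
Definition tau (X : Type) (A : set (set X)) : Type := X.

Definition tau_subbase (X : Type) (A : set (set X)) : set (set X) :=
  A `|` [set ~` a | a in A].

HB.instance Definition _ (X : Type) (A : set (set X)) := gen_eqMixin (tau A).
HB.instance Definition _ (X : Type) (A : set (set X)) :=
  gen_choiceMixin (tau A).
HB.instance Definition _ (X : Type) (A : set (set X)) :=
  isSubBaseTopological.Build (tau A) (tau_subbase A) id.

Definition pre_image_compact (P : Type) (M : model P) : Prop :=
  exists A : set (set M),
    (forall a, A a -> upset (@le P M) a) /\
    A set0 /\ A setT /\ (forall p, A (val p)) /\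
    (forall a b, A a -> A b -> A (a `|` b)) /\
    (forall a b, A a -> A b -> A (a `&` b)) /\
    (forall a b, A a -> A b -> A (ominus a b)) /\
    (forall x : M, compact (downset x : set (tau A))).

Definition bisimulation (P : Type) (M M' : model P) (B : M -> M' -> Prop) :
    Prop :=
  forall (x : M) (x' : M'), B x x' ->
    [/\ forall p, val p x <-> val p x',
        forall y : M, le y x -> exists y' : M', le y' x' /\ B y y' &
        forall y' : M', le y' x' -> exists y : M, le y x /\ B y y'].

Definition bisimilar (P : Type) (M M' : model P) (x : M) (x' : M') : Prop :=
  exists B : M -> M' -> Prop, bisimulation B /\ B x x'.

(* Main.v *)
(* A state [y] below [x] generates a filter on M': the sets containing every
   [y'] below [x'] with [y' |= phi] and [~ y' |= psi], for some [phi] true at [y]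
   and [psi] false at [y].  It is proper because [x |= phi -< psi], and the truth
   sets are clopen for [tau A], so any cluster point in the compact set
   [downset x'] has the same theory as [y].  Hence logical equivalence is itself
   a bisimulation. *)

From mathcomp Require Import all_boot.
From mathcomp Require Import boolp classical_sets.
From mathcomp Require Import topology_structure compact filter.
Require Import Defs.

Set Implicit Arguments.
Unset Strict Implicit.
Unset Printing Implicit Defensive.

Local Open Scope classical_set_scope.

Definition log_equiv (P : Type) (M M' : model P) (x : M) (x' : M') : Prop :=
  forall phi : formula P, sat x phi <-> sat x' phi.

Lemma log_equiv_sym (P : Type) (M M' : model P) (x : M) (x' : M') :
  log_equiv x x' -> log_equiv x' x.
Proof. by move=> xx' phi; apply: iff_sym. Qed.

(** Induction on [phi] for all [B]-related pairs at once, since [Sub] looks at states below; its two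
    directions use the forth and back clauses. *)
Lemma bisimulation_log_equiv (P : Type) (M M' : model P) (B : M -> M' -> Prop)
    (x : M) (x' : M') :
  bisimulation B -> B x x' -> log_equiv x x'.
Proof.
move=> bisB Bxx' phi.
elim: phi x x' Bxx' => [||p|f IHf g IHg|f IHf g IHg|f IHf g IHg] x x' Bxx' //=.
- by case: (bisB _ _ Bxx').
- by rewrite (propext (IHf _ _ Bxx')) (propext (IHg _ _ Bxx')).
- by rewrite (propext (IHf _ _ Bxx')) (propext (IHg _ _ Bxx')).
case: (bisB _ _ Bxx') => _ forth back; split.
- move=> [y [yx yf yg]]; have [y' [y'x' Byy']] := forth _ yx.
  by exists y'; split=> //; [apply/(IHf _ _ Byy')|move/(IHg _ _ Byy')].
- move=> [y' [y'x' y'f y'g]]; have [y [yx Byy']] := back _ y'x'.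
  by exists y; split=> //; [apply/(IHf _ _ Byy')|move/(IHg _ _ Byy')].
Qed.

Lemma tau_subbase_open (X : Type) (A : set (set X)) (a : set X) :
  tau_subbase A a -> open (a : set (tau A)).
Proof.
move=> Aa; exists [set a]; last by rewrite bigcup_set1.
by move=> _ ->; apply: finI_from1.
Qed.

Definition type_filter (P : Type) (M M' : model P) (y : M) (x' : M') :
    set (set M') :=
  [set S | exists phi psi, [/\ sat y phi, ~ sat y psi &
     forall y' : M', le y' x' -> sat y' phi -> ~ sat y' psi -> S y']].

Lemma type_filter_proper (P : Type) (M M' : model P) (x y : M) (x' : M') :
  log_equiv x x' -> le y x -> ProperFilter (type_filter y x').
Proof.
move=> xx' yx; split.
  move=> [phi [psi [yphi ypsi H]]].
  have /(xx' (Sub phi psi))[y' [y'x' y'phi y'psi]] : sat x (Sub phi psi).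
    by exists y.
  exact: (H y').
split=> [|S T [f [g [yf yg H]]] [f' [g' [yf' yg' H']]]|S T ST].
- by exists (@Top P), (@Bot P); split.
(* Conjoining the true formulas and disjoining the false ones turns two pairs into one, which gives
   closure under intersection. *)
- exists (And f f'), (Or g g'); split=> /=; [by []|by case|].
  move=> y' y'x' [y'f y'f'] /not_orP[y'g y'g'].
  by split; [apply: H|apply: H'].
- move=> [f [g [yf yg H]]]; exists f, g; split=> // y' *.
  by apply: ST; apply: H.
Qed.

Lemma log_equiv_below (P : Type) (M M' : model P) (x y : M) (x' : M') :
  pre_image_compact M' -> log_equiv x x' -> le y x ->
  exists y' : M', le y' x' /\ log_equiv y y'.
Proof.
move=> [A [_ [A0 [AT [Aval [AU [AI [Aominus Acompact]]]]]]]] xx' yx.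
(* Each closure condition on [A] matches one constructor, so truth sets and their complements are
   subbasic. *)
have Asat phi : A [set z : M' | sat z phi].
  elim: phi => [||p|f Af g Ag|f Af g Ag|f Af g Ag].
  - exact: AT.
  - exact: A0.
  - exact: Aval.
  - exact: AI Af Ag.
  - exact: AU Af Ag.
  - exact: Aominus Af Ag.
(* The pair [Top], [Bot] constrains nothing beyond lying below [x']. *)
have Fdown : type_filter y x' (downset x').
  by exists (@Top P), (@Bot P); split.
have [z [zx' clz]] :=
  Acompact x' (type_filter y x') (type_filter_proper xx' yx) Fdown.
have nbhs_subbase (N : set M') :
    tau_subbase A N -> N z -> nbhs (z : tau A) (N : set (tau A)).
  by move=> AN Nz; apply: open_nbhs_nbhs; split=> //; apply: tau_subbase_open.
(* Were [y] and [z] to differ on [phi], the truth set of [phi] and its complement would be, in some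
   order, a member of the filter and a neighbourhood of the cluster point [z]; these must meet. *)
exists z; split=> // phi; split=> [yphi|zphi]; apply: contrapT => nphi.
- have Fphi : type_filter y x' [set w | sat w phi].
    by exists phi, (@Bot P); split.
  have [|w [wphi nwphi]] := clz _ (~` [set w : M' | sat w phi]) Fphi.
    by apply: nbhs_subbase => //; right; exists [set w : M' | sat w phi].
  exact: nwphi.
- have Fphi : type_filter y x' (~` [set w | sat w phi]).
    by exists (@Top P), phi; split.
  have [|w [nwphi wphi]] := clz _ [set w : M' | sat w phi] Fphi.
    by apply: nbhs_subbase => //; left.
  exact: nwphi.
Qed.

Theorem theorem4p9 (P : Type) (M M' : model P)
    (hM : pre_image_compact M) (hM' : pre_image_compact M')
    (x : M) (x' : M') :
  bisimilar x x' <-> (forall phi : formula P, sat x phi <-> sat x' phi).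
Proof.
split=> [[B [bisB Bxx']]|xx']; first exact: bisimulation_log_equiv bisB Bxx'.
exists (@log_equiv P M M'); split=> // {xx'} {}x {}x' xx'; split.
- by move=> p; apply: (xx' (Var p)).
- by move=> y yx; apply: (log_equiv_below hM' xx' yx).
- move=> y' y'x'.
  have [y [yx /log_equiv_sym yy']] :=
    log_equiv_below hM (log_equiv_sym xx') y'x'.
  by exists y.
Qed.
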